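(* Let $U_7^2=\{L(C)\in TLeib_7 : c_{2,3}\neq 0,\ c_{1,1}=0,\ c_{0,1}\neq 0\}$. 1. Two algebras $L(C)$ and $L(C')$ from $U_7^2$ are isomorphic if and only if $$\frac{c'_{1,2}}{c'_{2,3}}=\frac{c_{1,2}}{c_{2,3}}\quad\text{and}\quad \frac{\left(c'_{1,3}c'_{0,1}-2c'_{0,0}{c'}_{1,2}^{2}\right)^4}{{c'}_{2,3}^{4}{c'}_{0,1}^{5}}=\frac{\left(c_{1,3}c_{0,1}-2c_{0,0}c_{1,2}^2\right)^4}{c_{2,3}^4c_{0,1}^5}.$$ 2. For any $\lambda_1,\lambda_2\in\mathbb{C}$ there exists $L(C)\in U_7^2$ with $\frac{c_{1,2}}{c_{2,3}}=\lambda_1$ and $\frac{(c_{1,3}c_{0,1}-2c_{0,0}c_{1,2}^2)^4}{c_{2,3}^4c_{0,1}^5}=\lambda_2$. Moreover, the orbits (isomorphism classes) in $U_7^2$ are parameterized by the algebras $L(0,1,0,\lambda_1,\lambda_2,0,1)$, $\lambda_1,\lambda_2\in\mathbb{C}$: these algebras lie in $U_7^2$ and every algebra in $U_7^2$ is isomorphic to one of them.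
   Context: All algebras are over $\mathbb{C}$. For $C=(c_{0,0},c_{0,1},c_{1,1},c_{1,2},c_{1,3},c_{1,4},c_{2,3})\in\mathbb{C}^7$, $L(C)$ denotes the $7$-dimensional complex (Leibniz) algebra with basis $e_0,e_1,\dots,e_6$ and products (products of basis vectors not listed are zero): $[e_i,e_0]=e_{i+1}$ for $1\le i\le 5$; $[e_0,e_i]=-e_{i+1}$ for $2\le i\le 5$; $[e_0,e_0]=c_{0,0}e_6$; $[e_0,e_1]=-e_2+c_{0,1}e_6$; $[e_1,e_1]=c_{1,1}e_6$; $[e_1,e_2]=-[e_2,e_1]=c_{1,2}e_4+c_{1,3}e_5+c_{1,4}e_6$; $[e_1,e_3]=-[e_3,e_1]=c_{1,2}e_5+c_{1,3}e_6$; $[e_1,e_4]=-[e_4,e_1]=(c_{1,2}-c_{2,3})e_6$; $[e_2,e_3]=-[e_3,e_2]=c_{2,3}e_6$. $TLeib_7$ is the set of all $L(C)$, $C\in\mathbb{C}^7$. The entries of $C'$ are denoted $c'_{i,j}$, in the same order. ''Isomorphic'' means isomorphic as algebras over $\mathbb{C}$; an orbit is an isomorphism class. *)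

(* Defs.v *)
From HB Require Import structures.
From mathcomp Require Import all_boot all_order all_algebra.
From mathcomp Require Import classical_sets.

Set Implicit Arguments.
Unset Strict Implicit.
Unset Printing Implicit Defensive.

Import GRing.Theory.
Local Open Scope ring_scope.
Local Open Scope classical_set_scope.

(* A (not necessarily associative, commutative or unital) algebra with
   underlying vector space V is given by its product. *)
Notation algebra_on V := {bilinear V%type -> V%type -> V%type}.

Definition isomorphic (K : fieldType) (V W : lmodType K)
    (A : algebra_on V) (B : algebra_on W) : Prop :=
  exists f : {linear V -> W},
    bijective f /\ forall x y : V, f (A x y) = B (f x) (f y).

Record coefs (K : Type) := Coefs {
  c00 : K; c01 : K; c11 : K; c12 : K; c13 : K; c14 : K; c23 : K }.

Section LeibnizAlgebra.
Variable K : fieldType.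
Implicit Types (C : coefs K) (x y : 'rV[K]_7).

Definition e (k : nat) : 'rV[K]_7 := \row_j (j == k :> nat)%:R.

Definition basis_prod C (i j : nat) : 'rV[K]_7 :=
  match i, j with
  | (1 | 2 | 3 | 4 | 5), 0 => (e i.+1)%R
  | 0, (2 | 3 | 4 | 5) => (- e j.+1)%R
  | 0, 0 => (c00 C *: e 6)%R
  | 0, 1 => (- e 2 + c01 C *: e 6)%R
  | 1, 1 => (c11 C *: e 6)%R
  | 1, 2 => (c12 C *: e 4 + c13 C *: e 5 + c14 C *: e 6)%R
  | 2, 1 => (- (c12 C *: e 4 + c13 C *: e 5 + c14 C *: e 6))%R
  | 1, 3 => (c12 C *: e 5 + c13 C *: e 6)%R
  | 3, 1 => (- (c12 C *: e 5 + c13 C *: e 6))%R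
  | 1, 4 => ((c12 C - c23 C) *: e 6)%R
  | 4, 1 => (- ((c12 C - c23 C) *: e 6))%R
  | 2, 3 => (c23 C *: e 6)%R
  | 3, 2 => (- (c23 C *: e 6))%R
  | _, _ => (0)%R
  end%N.

Definition bracket C x y : 'rV[K]_7 :=
  \sum_(i < 7) \sum_(j < 7) (x 0 i * y 0 j) *: basis_prod C i j.

Lemma bracket_is_bilinear C : bilinear_for *:%R *:%R (bracket C).
Proof.
split=> [y a x x' | x a y y']; rewrite /bracket /=;
  rewrite scaler_sumr -big_split; apply: eq_bigr => i _ /=;
  rewrite scaler_sumr -big_split; apply: eq_bigr => j _ /=;
  rewrite !mxE scalerA -scalerDl.
  by rewrite mulrDl mulrA.
by rewrite mulrDr mulrCA.
Qed.

HB.instance Definition _ C :=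
  bilinear_isBilinear.Build K 'rV[K]_7 'rV[K]_7 'rV[K]_7 *:%R *:%R
    (bracket C) (bracket_is_bilinear C).

Definition L C : algebra_on 'rV[K]_7 := bracket C.

Lemma LE C (i j : nat) : (i < 7)%N -> (j < 7)%N ->
  L C (e i) (e j) = basis_prod C i j.
Proof.
move=> lt_i lt_j; rewrite /L /= /bracket.
rewrite (bigD1 (Ordinal lt_i)) //= [X in _ + X]big1 ?addr0; last first.
  move=> k ne_ki; apply: big1 => l _; rewrite !mxE.
  by rewrite -[_ == i]/(k == Ordinal lt_i) (negPf ne_ki) mul0r scale0r.
rewrite (bigD1 (Ordinal lt_j)) //= [X in _ + X]big1 ?addr0; last first.
  move=> l ne_lj; rewrite !mxE.
  by rewrite -[l == j :> nat]/(l == Ordinal lt_j) (negPf ne_lj) mulr0 scale0r.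
by rewrite !mxE !eqxx mulr1 scale1r.
Qed.

Definition TLeib7 : set (algebra_on 'rV[K]_7) := range L.

Definition U72 : set (algebra_on 'rV[K]_7) :=
  [set L C | C in [set C | [/\ c23 C != 0, c11 C = 0 & c01 C != 0]]].

Lemma U72_sub_TLeib7 : U72 `<=` TLeib7.
Proof. by move=> _ [C _ <-]; exists C. Qed.

Lemma L_inj : injective L.
Proof.
move=> [a00 a01 a11 a12 a13 a14 a23] [b00 b01 b11 b12 b13 b14 b23] eqL.
have E i j (k : 'I_7) : (i < 7)%N -> (j < 7)%N ->
    basis_prod (Coefs a00 a01 a11 a12 a13 a14 a23) i j 0 k =
    basis_prod (Coefs b00 b01 b11 b12 b13 b14 b23) i j 0 k.
  by move=> lt_i lt_j; rewrite -!LE // eqL.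
have := (E 0 0 (inord 6) isT isT, E 0 1 (inord 6) isT isT,
         E 1 1 (inord 6) isT isT, E 1 2 (inord 4) isT isT,
         E 1 2 (inord 5) isT isT, E 1 2 (inord 6) isT isT,
         E 2 3 (inord 6) isT isT)%N.
rewrite /basis_prod !mxE !inordK //= !(mulr0, mulr1, addr0, add0r, oppr0).
by do 6! case; do 7! move->.
Qed.

Lemma U72LE C : U72 (L C) <-> [/\ c23 C != 0, c11 C = 0 & c01 C != 0].
Proof.
by split=> [[D ? /L_inj <-] // | ?]; exists C.
Qed.

Definition inv1 C : K := c12 C / c23 C.

Definition inv2 C : K :=
  (c13 C * c01 C - 2 * c00 C * c12 C ^+ 2) ^+ 4 / (c23 C ^+ 4 * c01 C ^+ 5).

End LeibnizAlgebra.

(* Main.v *)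
From HB Require Import structures.
Require Import Defs.
From mathcomp Require Import all_boot all_order all_algebra.
From mathcomp Require Import ring.
From mathcomp Require Import complex.
From mathcomp Require Import classical_sets reals.

(** The algebras L C are generated by e_0 and e_1, since right multiplication
    by e_0 carries e_1 to e_2, ..., e_6 in turn.  So an isomorphism
    f : L C -> L C' is determined by u = f e_0 and v = f e_1.

    Invariance.  In the coordinates of u and v, f e_6 = R_u^5 v has the single
    nonzero coordinate D u_0^4, where D = v_1 u_0 - v_0 u_1; hence D and u_0
    are nonzero.  Since [e_1, [e_1, e_0]] lies in the span of e_4, e_5, e_6,
    the e_3-coordinate - v_0 D of its image vanishes, so v_0 = 0.  Comparing
    leading coordinates in the images of the defining products then gives, with
    a = u_0, b = v_1 and t = u_1,
    - c_00 = (a c'_00 + t c'_01) / (a^4 b),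
    - c_01 = c'_01 / a^4,
    - c_12 = b c'_12 / a^2  and  c_23 = b c'_23 / a^2,
    - c_13 = b (a c'_13 + 2 t c'_12^2) / a^4
    ([isomorphic_coefs]).  The combination c_13 c_01 - 2 c_00 c_12^2 is the one
    in which t cancels: it is multiplied by b / a^7, so both quotients are
    unchanged ([isomorphic_inv]).

    Completeness.  Three elementary changes of basis realise these
    transformations: moving e_0 to e_0 + t e_1 kills c_00 because c_01 is
    nonzero ([shift_e0]); moving e_1 to e_1 + s e_3 kills c_14 because c_23 is
    nonzero ([shift_e1]); rescaling by a fourth root r of c_01 makes c_01 and
    c_23 equal to 1 ([rescale]).  The outcome is
    L(0, 1, 0, c_12 / c_23, x, 0, 1) with
    x = (c_13 c_01 - 2 c_00 c_12^2) / (c_23 r^5) ([isomorphic_normal]), and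
    x^4 is the second invariant.  Equal invariants thus leave x determined up
    to a fourth root of unity, and replacing r by z r with z^4 = 1 divides x
    by z^5 = z, so two algebras with equal invariants share a normal form
    ([normal_c13_adjust]). *)

Set Implicit Arguments.
Unset Strict Implicit.
Unset Printing Implicit Defensive.

Import GRing.Theory.
Local Open Scope ring_scope.
Local Open Scope complex_scope.

Local Notation "x '@' k" := (x 0 (inord k))
  (at level 2, k at level 1, format "x '@' k").

(** * Isomorphisms of algebras *)

Section Isomorphic.
Variable K : fieldType.

Lemma isomorphic_intro (V W : lmodType K) (A : algebra_on V) (B : algebra_on W)
    (f : V -> W) (g : W -> V) :
  linear f -> cancel f g -> cancel g f ->
  (forall x y, f (A x y) = B (f x) (f y)) -> isomorphic A B.
Proof.
move=> f_lin fK gK fA.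
pose F : {linear V -> W} := HB.pack f (GRing.isLinear.Build K V W *:%R f f_lin).
by exists F; split; first exists g.
Qed.

Lemma isomorphic_sym (V W : lmodType K) (A : algebra_on V) (B : algebra_on W) :
  isomorphic A B -> isomorphic B A.
Proof.
move=> [f [[g fK gK] fA]].
apply: (@isomorphic_intro _ _ _ _ g f) => //.
  by move=> a x y; apply: (can_inj fK); rewrite linearP !gK.
by move=> x y; apply: (can_inj fK); rewrite fA !gK.
Qed.

Lemma isomorphic_trans (U V W : lmodType K) (A : algebra_on U)
    (B : algebra_on V) (C : algebra_on W) :
  isomorphic A B -> isomorphic B C -> isomorphic A C.
Proof.
move=> [f [[f' fK f'K] fA]] [g [[g' gK g'K] gB]].
apply: (@isomorphic_intro _ _ _ _ (g \o f) (f' \o g')).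
- by move=> a x y; rewrite /= !linearP.
- exact: can_comp.
- exact: can_comp.
- by move=> x y; rewrite /= fA gB.
Qed.

End Isomorphic.

(** * Coordinates *)

Section Coordinates.
Variable K : fieldType.
Implicit Types (C : coefs K) (x y : 'rV[K]_7).

Lemma row7P x y :
  [/\ x@0 = y@0, x@1 = y@1 & x@2 = y@2] ->
  [/\ x@3 = y@3, x@4 = y@4, x@5 = y@5 & x@6 = y@6] -> x = y.
Proof.
move=> [? ? ?] [? ? ? ?]; apply/rowP=> k; rewrite -(inord_val k).
by case: k => -[|[|[|[|[|[|[|]]]]]]].
Qed.

Lemma big_ord7 (V : nmodType) (F : 'I_7 -> V) :
  \sum_(i < 7) F i =
  F (inord 0) + F (inord 1) + F (inord 2) + F (inord 3)
  + F (inord 4) + F (inord 5) + F (inord 6).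
Proof.
under eq_bigr do rewrite -[X in F X]inord_val.
rewrite -(big_mkord xpredT (fun i => F (inord i))).
by rewrite unlock /= !addrA addr0.
Qed.

Lemma bracket_coord C x y :
  ((L C x y)@0 = 0) * ((L C x y)@1 = 0)
  * ((L C x y)@2 = x@1 * y@0 - x@0 * y@1)
  * ((L C x y)@3 = x@2 * y@0 - x@0 * y@2)
  * ((L C x y)@4 = x@3 * y@0 - x@0 * y@3 + c12 C * (x@1 * y@2 - x@2 * y@1))
  * ((L C x y)@5 = x@4 * y@0 - x@0 * y@4 + c12 C * (x@1 * y@3 - x@3 * y@1)
       + c13 C * (x@1 * y@2 - x@2 * y@1))
  * ((L C x y)@6 = x@5 * y@0 - x@0 * y@5
       + c00 C * (x@0 * y@0) + c01 C * (x@0 * y@1) + c11 C * (x@1 * y@1)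
       + c14 C * (x@1 * y@2 - x@2 * y@1) + c13 C * (x@1 * y@3 - x@3 * y@1)
       + (c12 C - c23 C) * (x@1 * y@4 - x@4 * y@1)
       + c23 C * (x@2 * y@3 - x@3 * y@2)).
Proof.
(* The basis is made opaque, so that computing coordinates only meets e_k
   through eE. *)
have eE (k j : nat) : (j < 7)%N -> (e K k)@j = (j == k)%:R.
  by move=> lt_j; rewrite mxE inordK.
rewrite /L /= /bracket !big_ord7 !inordK //=.
move: (e K) eE => b bE.
by do !split; rewrite !mxE ?bE //=; ring.
Qed.

Definition row7 (a0 a1 a2 a3 a4 a5 a6 : K) : 'rV[K]_7 :=
  \row_k nth 0 [:: a0; a1; a2; a3; a4; a5; a6] k.

Lemma row7_coord a0 a1 a2 a3 a4 a5 a6 :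
  let v := row7 a0 a1 a2 a3 a4 a5 a6 in
  (v@0 = a0) * (v@1 = a1) * (v@2 = a2) * (v@3 = a3) * (v@4 = a4)
  * (v@5 = a5) * (v@6 = a6).
Proof. by do !split; rewrite mxE inordK. Qed.

Lemma lincomb_coord (a : K) x y (i : 'I_7) :
  (a *: x + y) 0 i = a * x 0 i + y 0 i.
Proof. by rewrite !mxE. Qed.

Definition coordE := (row7_coord, bracket_coord, lincomb_coord).

End Coordinates.

(** * Elementary changes of basis *)

Section BasisChange.
Variable K : fieldType.
Implicit Types (C : coefs K) (x y : 'rV[K]_7).

(** The new basis of L C starts with e_0 + t e_1 and e_1; [e_0, e_0] moves by
    t ([e_0, e_1] + [e_1, e_0]) = t c_01 e_6.  The leading change of e_4 is
    - 2 t c_12 e_5, so rewriting [e_1, e_2] in the new basis adds 2 t c_12^2 to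
    c_13.  The new c_14 is left unspecified: when 2 c_23 is nonzero, [shift_e1]
    can give it any value. *)
Lemma shift_e0 C (t : K) : c11 C = 0 -> exists d : K,
  isomorphic
    (L (Coefs (c00 C + t * c01 C) (c01 C) 0 (c12 C)
              (c13 C + 2 * t * c12 C ^+ 2) d (c23 C)))
    (L C).
Proof.
case: C => a00 a01 a11 a b c d /= a11_0; rewrite {a11}a11_0.
(* f sends e_k to the new basis vector e'_k, where e'_(k+1) = [e'_k, e'_0]; in
   particular e'_4 = e_4 - 2 t a e_5 + q e_6 and e'_5 = e_5 - r e_6. *)
pose q := t ^+ 2 * a * (a - d) - 2 * t * b.
pose r := t * (3 * a - d).
exists (c - a * q + (b + 2 * t * a ^+ 2) * r).
pose f x := row7 (x@0) (x@1 + t * x@0) (x@2) (x@3) (x@4 - t * a * x@3)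
  (x@5 - 2 * t * a * x@4 - t * b * x@3)
  (x@6 - t * c * x@3 + q * x@4 - r * x@5).
pose g y :=
  let x4 := y@4 + t * a * y@3 in
  let x5 := y@5 + 2 * t * a * x4 + t * b * y@3 in
  row7 (y@0) (y@1 - t * y@0) (y@2) (y@3) x4 x5
    (y@6 + t * c * y@3 - q * x4 + r * x5).
apply: (@isomorphic_intro _ _ _ _ _ f g) => [k x y | x | x | x y];
  apply: row7P; split; rewrite !coordE /= ?/q ?/r; ring.
Qed.

(** Replacing e_1 by e_1 + s e_3, hence e_k by e_k + s e_(k+2) for 2 <= k <= 4,
    affects [e_1, e_2] only in its e_6 component, by
    s (c_12 - c_23) - s c_23 - s c_12 = - 2 s c_23, the terms coming from
    [e_1, e_4], from [e_3, e_2] and from the change of e_4 in c_12 e_4. *)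
Lemma shift_e1 C (s : K) : c11 C = 0 ->
  isomorphic
    (L (Coefs (c00 C) (c01 C) 0 (c12 C) (c13 C) (c14 C - 2 * s * c23 C)
              (c23 C)))
    (L C).
Proof.
case: C => a00 a01 a11 a b c d /= a11_0; rewrite {a11}a11_0.
pose f x := row7 (x@0) (x@1) (x@2) (x@3 + s * x@1) (x@4 + s * x@2)
  (x@5 + s * x@3) (x@6 + s * x@4).
pose g y := row7 (y@0) (y@1) (y@2) (y@3 - s * y@1) (y@4 - s * y@2)
  (y@5 - s * (y@3 - s * y@1)) (y@6 - s * (y@4 - s * y@2)).
apply: (@isomorphic_intro _ _ _ _ _ f g) => [k x y | x | x | x y];
  apply: row7P; split; rewrite !coordE /=; ring.
Qed.

(** Only e_0 and e_1 are scaled freely, by a and b; the relation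
    e_(k+1) = [e_k, e_0] then scales e_k by a^(k-1) b. *)
Lemma rescale C (a b : K) : c11 C = 0 -> a != 0 -> b != 0 ->
  isomorphic
    (L (Coefs (c00 C / (a ^+ 3 * b)) (c01 C / a ^+ 4) 0 (c12 C * b / a ^+ 2)
              (c13 C * b / a ^+ 3) (c14 C * b / a ^+ 4) (c23 C * b / a ^+ 2)))
    (L C).
Proof.
case: C => a00 a01 a11 a12 a13 a14 a23 /= a11_0 a_neq0 b_neq0.
rewrite {a11}a11_0.
pose f (a b : K) x := row7 (a * x@0) (b * x@1) (a * b * x@2) (a ^+ 2 * b * x@3)
  (a ^+ 3 * b * x@4) (a ^+ 4 * b * x@5) (a ^+ 5 * b * x@6).
apply: (@isomorphic_intro _ _ _ _ _ (f a b) (f a^-1 b^-1))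
  => [k x y | x | x | x y];
  apply: row7P; split; rewrite !coordE /=; field;
  rewrite ?a_neq0 ?b_neq0 //.
Qed.

End BasisChange.

(** * Invariance *)

(** Reduces an equation to a polynomial identity, to be checked by ring
    normalisation, modulo a known equation. *)
Lemma eq_of_subE (V : zmodType) (p q x y : V) :
  p = q -> x - y = p - q -> x = y.
Proof. by move=> -> /eqP; rewrite subrr subr_eq0 => /eqP. Qed.

Section Invariance.
Variable K : fieldType.
Implicit Types (C : coefs K) (x : 'rV[K]_7).

(** Here a, b and t are the coordinates u_0, v_1 and u_1 of u = f e_0 and
    v = f e_1, and every equation is one coordinate of the image under f of a
    defining product: e_6 of [e_0, e_0] and [e_0, e_1], e_4 and e_5 of
    [e_1, e_2], e_6 of [e_2, e_3]. *)
Lemma isomorphic_coefs C C' : isomorphic (L C) (L C') -> c11 C' = 0 ->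
  exists a b t : K, [/\ a != 0, b != 0,
    c00 C * (a ^+ 4 * b) = a * c00 C' + t * c01 C' & c01 C * a ^+ 4 = c01 C']
  /\ [/\ c12 C * a ^+ 2 = c12 C' * b,
    c13 C * a ^+ 4 = (a * c13 C' + 2 * t * c12 C' ^+ 2) * b
    & c23 C * a ^+ 2 = c23 C' * b].
Proof.
move=> [f [/bij_inj f_inj fL]] c11'_0.
have fE (i j : nat) : (i < 7)%N -> (j < 7)%N ->
    f (basis_prod C i j) = L C' (f (e K i)) (f (e K j)).
  by move=> lt_i lt_j; rewrite -LE // fL.
pose u := f (e K 0); pose v := f (e K 1).
have f2 : f (e K 2) = L C' v u by exact: (fE 1 0)%N.
have f3 : f (e K 3) = L C' (f (e K 2)) u by exact: (fE 2 0)%N.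
have f4 : f (e K 4) = L C' (f (e K 3)) u by exact: (fE 3 0)%N.
have f5 : f (e K 5) = L C' (f (e K 4)) u by exact: (fE 4 0)%N.
have f6 : f (e K 6) = L C' (f (e K 5)) u by exact: (fE 5 0)%N.
pose D := v@1 * u@0 - v@0 * u@1.
(* f e_6 has only one coordinate that need not vanish, namely this one. *)
have f6_neq0 : D * u@0 ^+ 4 != 0.
  apply/eqP=> f6_0; have /f_inj/rowP/(_ (inord 6)) : f (e K 6) = f 0.
    rewrite linear0; apply: row7P; split;
      rewrite f6 f5 f4 f3 f2 !bracket_coord ?mxE //; try ring.
    by rewrite -[RHS]f6_0 /D; ring.
  by rewrite !mxE inordK //= => /eqP; rewrite oner_eq0.
have [D_neq0 u0_neq0] : D != 0 /\ u@0 != 0.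
  by move: f6_neq0; rewrite mulf_eq0 expf_eq0 /= => /norP.
(* The e_3-coordinate of the image of [e_1, [e_1, e_0]]. *)
have v0_0 : v@0 = 0.
  have /(congr1 (fun x => x@3)) := fE 1%N 2%N isT isT.
  rewrite /= !linearD !linearZ !mxE /= f6 f5 f4 f3 f2 !bracket_coord.
  move=> eq_0; apply: (mulIf D_neq0); apply: eq_of_subE eq_0 _.
  by rewrite /D; ring.
have D_E : D = u@0 * v@1 by rewrite /D v0_0; ring.
have v1_neq0 : v@1 != 0.
  by move: D_neq0; rewrite D_E mulf_eq0 => /norP[].
exists (u@0), (v@1), (u@1).
have f_coord (i j k : nat) : (i < 7)%N -> (j < 7)%N ->
    (f (basis_prod C i j))@k = (L C' (f (e K i)) (f (e K j)))@k.
  by move=> lt_i lt_j; rewrite fE.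
have := (f_coord 0 0 6 isT isT, f_coord 0 1 6 isT isT, f_coord 1 2 4 isT isT,
  f_coord 1 2 5 isT isT, f_coord 2 3 6 isT isT)%N.
rewrite /= !(linearD, linearN, linearZ) /= -/u -/v !mxE f6 f5 f4 f3 f2.
rewrite !bracket_coord v0_0 c11'_0.
case=> [] [] [] [] E00 E01 E12 E13 E23.
have E12' : c12 C * u@0 ^+ 2 = c12 C' * v@1.
  apply: (mulIf (mulf_neq0 u0_neq0 v1_neq0)); apply: eq_of_subE E12 _; ring.
split; split=> //.
- apply: (mulIf u0_neq0); apply: eq_of_subE E00 _; ring.
- apply: (mulIf (mulf_neq0 u0_neq0 v1_neq0)); apply: eq_of_subE E01 _; ring.
- have c12E : c12 C = c12 C' * v@1 / u@0 ^+ 2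
    by rewrite -E12'; field; rewrite ?u0_neq0.
  rewrite c12E in E13; apply: (mulIf v1_neq0); apply: eq_of_subE E13 _; field.
  by rewrite u0_neq0.
- apply: (mulIf (mulf_neq0 (expf_neq0 3 u0_neq0) v1_neq0)).
  apply: eq_of_subE E23 _; ring.
Qed.

Lemma isomorphic_inv C C' : U72 (L C) -> U72 (L C') ->
  isomorphic (L C) (L C') -> inv1 C' = inv1 C /\ inv2 C' = inv2 C.
Proof.
case: C C' => [a00 a01 a11 a12 a13 a14 a23] [b00 b01 b11 b12 b13 b14 b23].
move=> /U72LE /= [a23_neq0 _ a01_neq0] /U72LE /= [b23_neq0 b11_0 b01_neq0].
move=> /isomorphic_coefs /(_ b11_0) /= [a [b [t []]]].
move=> [a_neq0 b_neq0 E00 E01] [E12 E13 E23].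
have [A00 A01 A12] : [/\ a00 = (a * b00 + t * b01) / (a ^+ 4 * b),
  a01 = b01 / a ^+ 4 & a12 = b12 * b / a ^+ 2].
  by rewrite -E00 -E01 -E12; split; field; rewrite ?a_neq0 ?b_neq0.
have [A13 A23] : a13 = (a * b13 + 2 * t * b12 ^+ 2) * b / a ^+ 4
    /\ a23 = b23 * b / a ^+ 2.
  by rewrite -E13 -E23; split; field; rewrite ?a_neq0 ?b_neq0.
rewrite /inv1 /inv2 /= A00 A01 A12 A13 A23.
by split; field; rewrite ?a_neq0 ?b_neq0 ?b23_neq0 ?b01_neq0.
Qed.

End Invariance.

(** * Normal form and classification *)

(** A fourth root of the second invariant, when r is a fourth root of c_01. *)
Definition normal_c13 (K : fieldType) (C : coefs K) (r : K) : K :=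
  (c13 C * c01 C - 2 * c00 C * c12 C ^+ 2) / (c23 C * r ^+ 5).

(** The shift t = - c_00 / c_01 kills c_00 and turns c_13 into
    (c_13 c_01 - 2 c_00 c_12^2) / c_01; the factor b = r^2 / c_23 is the one for
    which the rescaling by r and b normalises c_23 as well as c_01. *)
Lemma isomorphic_normal (K : fieldType) (C : coefs K) (r : K) :
  (2 : K) != 0 -> U72 (L C) -> r ^+ 4 = c01 C ->
  isomorphic (L C) (L (Coefs 0 1 0 (inv1 C) (normal_c13 C r) 0 1)).
Proof.
move=> two_neq0 /U72LE [d_neq0 c11_0 c01_neq0] r4; apply: isomorphic_sym.
have r_neq0 : r != 0.
  by apply: contraNneq c01_neq0 => r_0; rewrite -r4 r_0 expr0n.
have [c' iso1] := @shift_e0 K C (- c00 C / c01 C) c11_0.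
set C1 := Coefs _ _ _ _ _ _ _ in iso1.
have iso2 := @shift_e1 K C1 (c' / (2 * c23 C)) erefl.
set C2 := Coefs _ _ _ _ _ _ _ in iso2.
have b_neq0 : r ^+ 2 / c23 C != 0 by rewrite mulf_neq0 ?expf_neq0 ?invr_eq0.
have iso3 := @rescale K C2 r (r ^+ 2 / c23 C) erefl r_neq0 b_neq0.
have := isomorphic_trans iso3 (isomorphic_trans iso2 iso1).
congr (isomorphic (L _) _); rewrite /C2 /C1 /= /inv1 /normal_c13 -r4.
by congr Coefs; field; rewrite ?two_neq0 ?d_neq0 ?r_neq0.
Qed.

(** The two values of normal_c13 have the same fourth power, so their ratio z is
    a fourth root of unity, and multiplying r' by z divides normal_c13 by
    z^5 = z. *)
Lemma normal_c13_adjust (K : fieldType) (C C' : coefs K) (r r' : K) :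
  r ^+ 4 = c01 C -> r' ^+ 4 = c01 C' -> inv2 C' = inv2 C ->
  exists2 s, s ^+ 4 = c01 C' & normal_c13 C' s = normal_c13 C r.
Proof.
move=> r4 r'4.
have inv2E (D : coefs K) (t : K) : t ^+ 4 = c01 D ->
    inv2 D = normal_c13 D t ^+ 4.
  move=> t4; rewrite /inv2 /normal_c13 expr_div_n exprMn.
  by rewrite -!exprM -t4 -exprM.
rewrite (inv2E _ _ r4) (inv2E _ _ r'4) => eq4.
have [x'_0|x'_neq0] := eqVneq (normal_c13 C' r') 0.
  exists r' => //; rewrite x'_0; move/esym/eqP: eq4.
  by rewrite x'_0 expr0n expf_eq0 /= => /eqP.
have x_neq0 : normal_c13 C r != 0.
  apply: contra_neq x'_neq0 => x_0; move/eqP: eq4.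
  by rewrite x_0 expr0n expf_eq0 => /eqP.
pose z := normal_c13 C' r' / normal_c13 C r.
have z4 : z ^+ 4 = 1 by rewrite expr_div_n eq4 divff ?expf_neq0.
exists (z * r'); first by rewrite exprMn z4 mul1r.
have -> : normal_c13 C' (z * r') = normal_c13 C' r' / z.
  rewrite /normal_c13 exprMn (exprSr z 4) z4 mul1r [c23 C' * _]mulrCA.
  by rewrite invfM mulrCA mulrC.
by rewrite /z invf_div mulrCA divff ?mulr1.
Qed.

Theorem proposition2p2 (R : realType) :
  [/\ forall C C' : coefs R[i], U72 (L C) -> U72 (L C') ->
        (isomorphic (L C) (L C') <->
         inv1 C' = inv1 C /\ inv2 C' = inv2 C),
      forall l1 l2 : R[i], exists C : coefs R[i],
        [/\ U72 (L C), inv1 C = l1 & inv2 C = l2],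
      forall l1 l2 : R[i], U72 (L (Coefs 0 1 0 l1 l2 0 1))
    & forall A : algebra_on 'rV[R[i]]_7, U72 A ->
        exists l1 l2 : R[i], isomorphic A (L (Coefs 0 1 0 l1 l2 0 1))].
Proof.
have two_neq0 : (2 : R[i]) != 0 by rewrite Num.Theory.pnatr_eq0.
have root4 (z : R[i]) : exists r, r ^+ 4 = z.
  by exists (Num.Theory.nthroot 4 z); rewrite Num.Theory.rootCK.
have U72_normal (l1 l2 : R[i]) : U72 (L (Coefs 0 1 0 l1 l2 0 1)).
  by apply/U72LE; split; rewrite ?oner_eq0.
split=> //.
- move=> C C' UC UC'; split; first exact: isomorphic_inv.
  move=> [eq1 eq2]; have [r r4] := root4 (c01 C).
  have [r' r'4] := root4 (c01 C').
  have [s s4 eq_n] := normal_c13_adjust r4 r'4 eq2.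
  (* Both algebras are isomorphic to the normal form of L C attached to r. *)
  apply: isomorphic_trans (isomorphic_normal two_neq0 UC r4) _.
  rewrite -eq1 -eq_n; apply: isomorphic_sym; exact: isomorphic_normal.
- move=> l1 l2; have [r r4] := root4 l2; exists (Coefs 0 1 0 l1 r 0 1).
  split=> //; first by rewrite /inv1 divr1.
  by rewrite /inv2 /= mulr0 mul0r subr0 mulr1 !expr1n mulr1 divr1.
- move=> _ [C UC <-]; have [r r4] := root4 (c01 C).
  exists (inv1 C), (normal_c13 C r); apply: isomorphic_normal => //.
  exact/U72LE.
Qed.
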